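(* Let $H$ be an intersecting $3$-graph with $n=|V(H)|\ge 6$. If $\tau(H)\le 2$, then $H$ is contained in one of $H(n),H_0(n),\ldots,H_5(n)$. Consequently, (a) if $|H|\ge 11$, then $H$ is contained in one of $H(n),H_0(n),\ldots,H_5(n)$; (b) if $|H|>n+4$, then $H$ is contained in $H(n)$, $H_0(n)$, $H_1(n)$ or $H_2(n)$.
   Context: A $3$-graph is a family of $3$-element subsets (edges) of a finite vertex set $V(H)$; it is intersecting if every two edges intersect; $\tau(H)$ is the minimum size of a vertex set meeting every edge. ''$H$ is contained in $K$'' for a construction $K$ on $n$ vertices means the special vertices of $K$ can be chosen among $V(H)$ so that every edge of $H$ is an edge of $K$. All constructions below are on an $n$-element vertex set ($n\ge 6$): $H(n)$: a full star, i.e. all triples containing a fixed vertex. $H_0(n)$: special vertices $x,x_1,x_2$; all triples containing at least two of them. $H_1(n)$: special vertices $x,x_1,x_2,y_1$; all triples containing $\{x,x_1\}$ or $\{x,x_2\}$ or $\{x,y_1\}$, plus the triple $\{x_1,x_2,y_1\}$. $H_2(n)$: special vertices $x,x_1,x_2,y_1,y_2$; all triples containing $\{x,x_1\}$ or $\{x,x_2\}$, plus the triples $\{x_1,x_2,y_1\}$, $\{x_1,x_2,y_2\}$, $\{x,y_1,y_2\}$. $H_3(n)$: special vertices $v_1,v_2,y_1,y_2,y_3$; the $n-2$ triples containing $\{v_1,v_2\}$ and the $6$ triples consisting of one of $v_1,v_2$ and two of $y_1,y_2,y_3$. $H_4(n)$ and $H_5(n)$: special vertices $v_1,v_2,a,a',b,b'$;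 both contain all triples containing $\{v_1,v_2\}$. In addition $H_4(n)$ contains $v_1aa', v_1bb', v_2ab, v_2ab', v_2a'b, v_2a'b'$, and $H_5(n)$ contains $v_1aa', v_1bb', v_1ab', v_2ab', v_2ab, v_2a'b'$. *)

(* Defs.v *)
From mathcomp Require Import all_boot.

Set Implicit Arguments.
Unset Strict Implicit.
Unset Printing Implicit Defensive.

(* A hypergraph with vertex set the whole finite type T is its set of edges. *)
Section Hypergraphs.
Variable T : finType.
Implicit Types (H : {set {set T}}) (S : {set T}).

Definition three_graph H := [forall e in H, #|e| == 3].

Definition intersecting H := [forall e in H, forall f in H, e :&: f != set0].

Definition covering H S := [forall e in H, S :&: e != set0].

(* The initial candidate [set: T] is covering as soon as no edge is empty,
   in particular for every 3-graph. *)
Definition tau H := #|[arg min_(S < [set: T] | covering H S) #|S| ]|.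

Definition triples_over S : {set {set T}} :=
  [set e : {set T} | (#|e| == 3) && (S \subset e)].

(* The constructions, as functions of their special vertices; they are
   meaningful only when the special vertices are pairwise distinct. *)

Definition HS (x : T) : {set {set T}} := triples_over [set x].

Definition H0 (x x1 x2 : T) : {set {set T}} :=
  [set e : {set T} | (#|e| == 3) && (2 <= #|e :&: [set x; x1; x2]|)].

Definition H1 (x x1 x2 y1 : T) : {set {set T}} :=
  triples_over [set x; x1] :|: triples_over [set x; x2]
    :|: triples_over [set x; y1] :|: [set [set x1; x2; y1]].

Definition H2 (x x1 x2 y1 y2 : T) : {set {set T}} :=
  triples_over [set x; x1] :|: triples_over [set x; x2]
    :|: [set [set x1; x2; y1]; [set x1; x2; y2]; [set x; y1; y2]].

Definition H3 (v1 v2 y1 y2 y3 : T) : {set {set T}} :=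
  triples_over [set v1; v2]
    :|: [set e : {set T} | [&& #|e| == 3, #|e :&: [set v1; v2]| == 1
                             & #|e :&: [set y1; y2; y3]| == 2]].

Definition H4 (v1 v2 a a' b b' : T) : {set {set T}} :=
  triples_over [set v1; v2]
    :|: [set [set v1; a; a']; [set v1; b; b'];
             [set v2; a; b]; [set v2; a; b'];
             [set v2; a'; b]; [set v2; a'; b']].

Definition H5 (v1 v2 a a' b b' : T) : {set {set T}} :=
  triples_over [set v1; v2]
    :|: [set [set v1; a; a']; [set v1; b; b']; [set v1; a; b'];
             [set v2; a; b']; [set v2; a; b]; [set v2; a'; b']].

Definition contained_HS H := exists x, H \subset HS x.

Definition contained_H0 H := exists x x1 x2,
  uniq [:: x; x1; x2] /\ H \subset H0 x x1 x2.

Definition contained_H1 H := exists x x1 x2 y1,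
  uniq [:: x; x1; x2; y1] /\ H \subset H1 x x1 x2 y1.

Definition contained_H2 H := exists x x1 x2 y1 y2,
  uniq [:: x; x1; x2; y1; y2] /\ H \subset H2 x x1 x2 y1 y2.

Definition contained_H3 H := exists v1 v2 y1 y2 y3,
  uniq [:: v1; v2; y1; y2; y3] /\ H \subset H3 v1 v2 y1 y2 y3.

Definition contained_H4 H := exists v1 v2 a a' b b',
  uniq [:: v1; v2; a; a'; b; b'] /\ H \subset H4 v1 v2 a a' b b'.

Definition contained_H5 H := exists v1 v2 a a' b b',
  uniq [:: v1; v2; a; a'; b; b'] /\ H \subset H5 v1 v2 a a' b b'.

Definition contained_HS_to_H2 H :=
  [\/ contained_HS H, contained_H0 H, contained_H1 H | contained_H2 H].

Definition contained_HS_to_H5 H :=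
  contained_HS_to_H2 H \/ [\/ contained_H3 H, contained_H4 H | contained_H5 H].

End Hypergraphs.

(* Main.v *)
Require Import Defs.
From mathcomp Require Import all_boot.

(* Fix two vertices v1, v2 covering H.  The edges through exactly one of them
   form two graphs on the other vertices, and every edge of one graph meets
   every edge of the other.  A graph is empty, a single edge, a path with two
   edges, or it contains a claw, a triangle or a 2-matching; comparing these
   shapes for two crossing graphs gives exactly the constructions H(n), H_0(n),
   ..., H_5(n).

   If tau(H) > 2, then |H| <= 10.  Let d be the maximal codegree, attained by
   {x, y}, and let N be the set of third vertices of the edges through x and y.
   Every edge missing x and y contains N, hence d <= 3.  If d <= 1, every degree
   is at most 3, and |H| <= 9.  If d >= 2, at most 4 edges contain both or
   neither of x, y, and the classification of crossing graphs shows that at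
   most 6 contain exactly one of them. *)

Set Implicit Arguments.
Unset Strict Implicit.
Unset Printing Implicit Defensive.

(** * Crossing graphs *)

(** An undirected graph given by an edge list, so that [size s] bounds its number of edges. *)
Definition joins (T : eqType) (s : seq (T * T)) : rel T :=
  fun c d => ((c, d) \in s) || ((d, c) \in s).

Lemma joinsC (T : eqType) (s : seq (T * T)) : symmetric (joins s).
Proof. by move=> c d; rewrite /joins orbC. Qed.

Definition crossing (T : eqType) (r1 r2 : rel T) :=
  forall a b c d, r1 a b -> r2 c d -> [\/ a = c, a = d, b = c | b = d].

Definition graph (T : eqType) (r : rel T) := symmetric r /\ irreflexive r.

(** The first three shapes determine the graph. The last three only exhibit a subgraph, which
    already confines every graph crossing it. *)
Variant graph_shape (T : eqType) (r : rel T) : Prop :=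
| ShapeEmpty of (forall a b, ~~ r a b)
| ShapeEdge a b of r a b & subrel r (joins [:: (a, b)])
| ShapePath w u v of r w u & r w v & u != v
    & subrel r (joins [:: (w, u); (w, v)])
| ShapeClaw w u1 u2 u3 of r w u1 & r w u2 & r w u3 & uniq [:: u1; u2; u3]
| ShapeTriangle a b c of r a b & r b c & r c a
| ShapeMatching a a' b b' of r a a' & r b b' & uniq [:: a; a'; b; b'].

(** The side conditions are Boolean combinations of equalities between vertices, so splitting on
    each equality leaves only trivial or congruence goals. *)
Ltac decide_eqs := rewrite /joins /= ?(inE, xpair_eqE, negb_or) /=;
  repeat match goal with
  | |- context [?x == ?y] =>
      is_var x; is_var y; case: (@eqP _ x y) => ? //=
  end; try done; try congruence.

Lemma graph_neq (T : eqType) (r : rel T) a b : graph r -> r a b -> a <> b.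
Proof. by move=> [_ irr] rab eab; move: rab; rewrite eab irr. Qed.

Lemma not_subrelP (T : finType) (r s : rel T) :
  subrel r s \/ exists a b, r a b /\ ~~ s a b.
Proof.
case: (boolP [exists a, exists b, r a b && ~~ s a b]) => [|no].
  by move=> /existsP[a /existsP[b /andP[]]]; right; exists a, b.
left=> a b rab; apply: contraNT no => nsab.
by apply/existsP; exists a; apply/existsP; exists b; rewrite rab.
Qed.

(** Edges are added one at a time until the list exhausts [r]. Two edges form a matching or a path.
    A third edge outside a path gives a claw if it contains the centre, a triangle if it joins the
    two ends, and otherwise a matching with one of the path's edges. *)
Lemma graphP (T : finType) (r : rel T) : graph r -> graph_shape r.
Proof.
move=> gr; have [sym irr] := gr.
have [sub0|[a [b [rab _]]]] := not_subrelP r (fun _ _ => false).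
  by apply: ShapeEmpty => a b; apply/negP => /sub0.
have [sub1|[c [d [rcd]]]] := not_subrelP r (joins [:: (a, b)]).
  exact: ShapeEdge rab sub1.
have path w u v : r w u -> r w v -> u != v -> graph_shape r.
  move=> rwu rwv uv.
  have [sub2|[c' [d' []]]] := not_subrelP r (joins [:: (w, u); (w, v)]).
    exact: ShapePath rwu rwv uv sub2.
  have claw x : r w x -> ~~ joins [:: (w, u); (w, v)] w x -> graph_shape r.
    move=> rwx nj; apply: ShapeClaw rwu rwv rwx _.
    by move: nj uv; decide_eqs.
  have [wu wv] := (graph_neq gr rwu, graph_neq gr rwv).
  case: (eqVneq c' w) => [->|c'w]; first exact: claw.
  case: (eqVneq d' w) => [->|d'w].
    by rewrite sym => rwc nj; apply: claw rwc _; move: nj; decide_eqs.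
  move=> rcd' _; have cd := graph_neq gr rcd'.
  have rvw : r v w by rewrite sym.
  case: (eqVneq c' u) => [?|c'u]; [subst c'|case: (eqVneq c' v) => [?|c'v]].
  - case: (eqVneq d' v) => [?|d'v].
      by subst; exact: ShapeTriangle rwu rcd' _.
    by apply: ShapeMatching rwv rcd' _; move: d'w d'v uv; decide_eqs.
  - subst c'; case: (eqVneq d' u) => [?|d'u].
      by subst; apply: ShapeTriangle rwu _ rvw; rewrite sym.
    by apply: ShapeMatching rwu rcd' _; move: d'w d'u uv; decide_eqs.
  case: (eqVneq d' u) => [?|d'u].
    by subst; apply: ShapeMatching rwv rcd' _; move: c'v c'w uv; decide_eqs.
  by apply: ShapeMatching rwu rcd' _; move: c'u c'w d'w d'u; decide_eqs.
have [ab cd] := (graph_neq gr rab, graph_neq gr rcd).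
have [rba rdc] : r b a /\ r d c by rewrite !(sym _ a) !(sym _ c).
case: (eqVneq c a) => [?|ca].
  by subst => nj; apply: (path a b d) => //; move: nj; decide_eqs.
case: (eqVneq d a) => [?|da].
  by subst => nj; apply: (path a b c) => //; move: nj; decide_eqs.
case: (eqVneq c b) => [?|cb].
  by subst => nj; apply: (path b a d) => //; move: da; decide_eqs.
case: (eqVneq d b) => [?|db].
  by subst => nj; apply: (path b a c) => //; move: ca; decide_eqs.
by move=> _; apply: ShapeMatching rab rcd _; move: ca da cb db; decide_eqs.
Qed.

(** In this order the cases lead to H(n), H_1, H_2, H_0, H_3, H_4 and H_5. The first three describe
    only one of the graphs; the crossing condition confines the other. The roles of [r1] and [r2]
    differ, so a classification holds up to exchanging them. *)
Variant cross_shape (T : eqType) (r1 r2 : rel T) : Prop :=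
| CrossEmpty of (forall a b, ~~ r1 a b)
| CrossEdge a b of r2 a b & subrel r2 (joins [:: (a, b)])
| CrossPath w u v of r2 w u & r2 w v & u != v
    & subrel r2 (joins [:: (w, u); (w, v)])
| CrossStar w u of r1 w u & (forall c d, r1 c d || r2 c d -> w = c \/ w = d)
| CrossTriangle a b c of r1 a b & r1 b c & r1 c a
    & (forall c' d', r1 c' d' || r2 c' d' ->
         joins [:: (a, b); (b, c); (c, a)] c' d')
| CrossH4 a a' b b' of r1 a a' & r1 b b' & uniq [:: a; a'; b; b']
    & subrel r1 (joins [:: (a, a'); (b, b')])
    & subrel r2 (joins [:: (a, b); (a, b'); (a', b); (a', b')])
| CrossH5 a a' b b' of r1 a a' & r1 b b' & uniq [:: a; a'; b; b']
    & subrel r1 (joins [:: (a, a'); (b, b'); (a, b')])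
    & subrel r2 (joins [:: (a, b'); (a, b); (a', b')]).

Lemma crossingC (T : eqType) (r1 r2 : rel T) :
  crossing r1 r2 -> crossing r2 r1.
Proof.
by move=> cr a b c d r2ab r1cd; case: (cr _ _ _ _ r1cd r2ab) => ->;
  [constructor 1 | constructor 3 | constructor 2 | constructor 4].
Qed.

(** An edge avoiding [w] would have to contain the three distinct leaves. *)
Lemma claw_cross (T : eqType) (r1 r2 : rel T) w u1 u2 u3 :
    crossing r1 r2 -> r1 w u1 -> r1 w u2 -> r1 w u3 -> uniq [:: u1; u2; u3] ->
  forall c d, r2 c d -> w = c \/ w = d.
Proof.
move=> cr r1u1 r1u2 r1u3 un c d r2cd; move: un.
move: (cr _ _ _ _ r1u1 r2cd) (cr _ _ _ _ r1u2 r2cd) (cr _ _ _ _ r1u3 r2cd).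
by move=> [?|?|?|?] [?|?|?|?] [?|?|?|?];
  (try by left); (try by right); decide_eqs.
Qed.

(** A pair meeting all three sides of a triangle contains two of its vertices. *)
Lemma triangle_cross (T : eqType) (r1 r2 : rel T) a b c :
    crossing r1 r2 -> graph r1 -> graph r2 -> r1 a b -> r1 b c -> r1 c a ->
  subrel r2 (joins [:: (a, b); (b, c); (c, a)]).
Proof.
move=> cr g1 g2 rab rbc rca x y rxy.
have := (graph_neq g1 rab, graph_neq g1 rbc, graph_neq g1 rca,
         graph_neq g2 rxy).
move: (cr _ _ _ _ rab rxy) (cr _ _ _ _ rbc rxy) (cr _ _ _ _ rca rxy).
move=> [?|?|?|?] [?|?|?|?] [?|?|?|?] [[[]]] *; subst;
  rewrite /joins !inE ?eqxx ?orbT //; decide_eqs.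
Qed.

Lemma matching_cross (T : eqType) (r1 r2 : rel T) a a' b b' :
    crossing r1 r2 -> r1 a a' -> r1 b b' -> uniq [:: a; a'; b; b'] ->
  subrel r2 (joins [:: (a, b); (a, b'); (a', b); (a', b')]).
Proof.
move=> cr ra rb un x y rxy; move: un.
by move: (cr _ _ _ _ ra rxy) (cr _ _ _ _ rb rxy) => [?|?|?|?] [?|?|?|?];
  subst; rewrite /joins !inE ?eqxx ?orbT //; decide_eqs.
Qed.

(** On the four vertices, [r1] contains one perfect matching and [r2] another, so by
    [matching_cross] only the edges ab' and a'b of the third one can be shared. If one graph uses
    neither of them, the pair has the H_4 shape. Otherwise, opposite edges cannot lie in different
    graphs, so both use the same single edge, which is the H_5 shape. *)
Lemma two_matchings_cross (T : eqType) (r1 r2 : rel T) a a' b b' :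
    crossing r1 r2 -> graph r1 -> graph r2 -> uniq [:: a; a'; b; b'] ->
    r1 a a' -> r1 b b' -> r2 a b -> r2 a' b' ->
  cross_shape r1 r2 \/ cross_shape r2 r1.
Proof.
move=> cr g1 g2 un r1aa r1bb r2ab r2ab'.
have [[sym1 _] [sym2 _]] := (g1, g2).
have s2 := matching_cross cr r1aa r1bb un.
have un2 : uniq [:: a; b; a'; b'] by move: un; decide_eqs.
have s1 := matching_cross (crossingC cr) r2ab r2ab' un2.
have disj c d c' d' : uniq [:: c; d; c'; d'] -> r1 c d -> ~~ r2 c' d'.
  move=> unc rcd; apply/negP => rcd'; move: unc.
  by case: (cr _ _ _ _ rcd rcd') => ->; decide_eqs.
have in_joins (r : rel T) s s' : symmetric r -> subrel r (joins s) ->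
    all (fun e => joins s' e.1 e.2 || ~~ r e.1 e.2) s -> subrel r (joins s').
  move=> sym sub /allP keep x y rxy; have := sub _ _ rxy.
  case/orP=> /keep /=; rewrite ?rxy ?(sym y) ?rxy ?orbF //.
  by rewrite /joins orbC.
have disj1 : r1 a b' -> ~~ r2 a' b by apply: disj; move: un; decide_eqs.
have disj2 : r1 a' b -> ~~ r2 a b' by apply: disj; move: un; decide_eqs.
have [r1some|/norP[r1ab' r1a'b]] := boolP (r1 a b' || r1 a' b); last first.
  left; apply: CrossH4 r1aa r1bb un _ s2; apply: in_joins s1 _ => //=.
  by rewrite r1ab' (sym1 b) r1a'b /joins !inE ?eqxx ?orbT.
have [r2some|/norP[r2ab1 r2ba1]] := boolP (r2 a b' || r2 a' b); last first.
  right; apply: CrossH4 r2ab r2ab' un2 _ s1; apply: in_joins s2 _ => //=.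
  by rewrite r2ab1 r2ba1 /joins !inE ?eqxx ?orbT.
left; case/orP: r1some => [r1ab'|r1a'b].
  have r2ba1 := disj1 r1ab'; rewrite (negPf r2ba1) orbF in r2some.
  have r1a'b : ~~ r1 a' b by apply: contraTN r2some.
  apply: CrossH5 r1aa r1bb un _ _; [apply: in_joins s1 _ | apply: in_joins s2 _];
    by rewrite //= ?r2ba1 ?(sym1 b) ?r1a'b /joins !inE ?eqxx ?orbT.
have r2ab1 := disj2 r1a'b; rewrite (negPf r2ab1) /= in r2some.
have r1ab' : ~~ r1 a b' by apply: contraTN r2some.
(* The shared edge is now a'b. Exchanging [a] with [a'] and [b] with [b'] turns this into the
   previous case. *)
rewrite sym1 in r1aa; rewrite sym1 in r1bb.
have un3 : uniq [:: a'; a; b'; b] by move: un; decide_eqs.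
apply: CrossH5 r1aa r1bb un3 _ _; [apply: in_joins s1 _ | apply: in_joins s2 _];
  by rewrite //= ?r2ab1 ?r1ab' /joins !inE ?eqxx ?orbT.
Qed.

(** A graph crossing a matching is bipartite between the two matching edges, so it has no odd
    cycle. *)
Lemma triangle_matching (T : eqType) (r1 r2 : rel T) a a' b b' x y z :
    graph r2 -> crossing r1 r2 -> r1 a a' -> r1 b b' ->
    uniq [:: a; a'; b; b'] -> r2 x y -> r2 y z -> r2 z x -> False.
Proof.
move=> g2 cr raa rbb un rxy ryz rzx.
have bip c d : r2 c d -> (c \in [:: a; a']) (+) (d \in [:: a; a']).
  move/(matching_cross cr raa rbb un); move: un; rewrite /joins !inE !xpair_eqE.
  by move=> un /orP[/or4P[]|/or4P[]] /andP[/eqP-> /eqP->]; move: un; decide_eqs.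
by move: (bip _ _ rxy) (bip _ _ ryz) (bip _ _ rzx); do 3!case: (_ \in _).
Qed.

(** If either graph is empty, an edge or a path, a constructor applies at once. Among the remaining
    pairs, a claw forces a common star, two triangles coincide, a triangle excludes a matching, and
    two matchings are treated by [two_matchings_cross]. *)
Lemma cross_shapeP (T : finType) (r1 r2 : rel T) :
    crossing r1 r2 -> graph r1 -> graph r2 ->
  cross_shape r1 r2 \/ cross_shape r2 r1.
Proof.
move=> cr g1 g2; have cr' := crossingC cr; have [[sym1 _] [sym2 _]] := (g1, g2).
have star : forall r r' : rel T, crossing r r' -> crossing r' r ->
    graph r -> graph r' ->
    (exists w u1 u2 u3, [/\ r w u1, r w u2, r w u3 & uniq [:: u1; u2; u3]]) ->
    graph_shape r' -> cross_shape r r' \/ cross_shape r' r.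
  move=> r r' crr crr' g g' [w [u1 [u2 [u3 [rw1 rw2 rw3 un]]]]].
  have r'w := claw_cross crr rw1 rw2 rw3 un.
  case=> [none|a b rab sub|c u v rcu rcv uv sub|c v1 v2 v3 rc1 rc2 rc3 un'
         |a b c rab rbc rca|a a' b b' raa rbb un'].
  - by right; apply: CrossEmpty.
  - by left; apply: CrossEdge rab sub.
  - by left; apply: CrossPath rcu rcv uv sub.
  - have rc := claw_cross crr' rc1 rc2 rc3 un'.
    left; apply: CrossStar rw1 _ => x y /orP[|/r'w //] rxy.
    (* The two claws share their centre: if [w] differed from [c], both [u2] and [u3] would equal
       [c]. *)
    suff -> : w = c by exact: rc rxy.
    by move: (rc _ _ rw2) (rc _ _ rw3) un => [|->] // [|->] //; decide_eqs.
  - have := (graph_neq g' rab, graph_neq g' rbc, graph_neq g' rca).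
    move: (r'w _ _ rab) (r'w _ _ rbc) (r'w _ _ rca).
    by move=> [?|?] [?|?] [?|?] [[]]; congruence.
  - move: (r'w _ _ raa) (r'w _ _ rbb) un'.
    by move=> [?|?] [?|?]; decide_eqs.
have sh2 := graphP g2.
case: (graphP g1) (sh2) => [none|a b rab sub|c u v rcu rcv uv sub
  |w u1 u2 u3 rw1 rw2 rw3 un|a b c rab rbc rca|a a' b b' raa rbb un].
- by left; apply: CrossEmpty.
- by right; apply: CrossEdge rab sub.
- by right; apply: CrossPath rcu rcv uv sub.
- by move=> _; apply: star => //; exists w, u1, u2, u3.
- have s2 := triangle_cross cr g1 g2 rab rbc rca.
  case=> [none|x y rxy sub|w u v rwu rwv uv sub|w v1 v2 v3 rc1 rc2 rc3 un'
         |x y z rxy ryz rzx|x x' y y' rxx ryy un'].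
  + by right; apply: CrossEmpty.
  + by left; apply: CrossEdge rxy sub.
  + by left; apply: CrossPath rwu rwv uv sub.
  + by apply/or_comm; apply: (star _ _ cr' cr g2 g1 _ (graphP g1));
      exists w, v1, v2, v3.
  + have s1 := triangle_cross cr' g2 g1 rxy ryz rzx.
    left; apply: CrossTriangle rab rbc rca _ => p q /orP[|/s2 //] rpq.
    case/orP: (s1 _ _ rpq); rewrite !inE => /or3P[] /eqP[-> ->];
      by [apply: s2 | rewrite joinsC; apply: s2].
  + by case: (triangle_matching g1 cr' rxx ryy un' rab rbc rca).
have s2 := matching_cross cr raa rbb un.
case=> [none|x y rxy sub|w u v rwu rwv uv sub|w v1 v2 v3 rc1 rc2 rc3 un'
       |x y z rxy ryz rzx|x x' y y' rxx ryy un'].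
- by right; apply: CrossEmpty.
- by left; apply: CrossEdge rxy sub.
- by left; apply: CrossPath rwu rwv uv sub.
- by apply/or_comm; apply: (star _ _ cr' cr g2 g1 _ (graphP g1));
      exists w, v1, v2, v3.
- by case: (triangle_matching g2 cr raa rbb un rxy ryz rzx).
(* A matching of [r2] inside the 4-cycle is one of two; exchanging [b] and [b'] carries one to the
   other. *)
have un3 : uniq [:: a; a'; b'; b] by move: un; decide_eqs.
have rbb' : r1 b' b by rewrite sym1.
have flip p q : r2 p q -> r2 q p by rewrite sym2.
have done1 : r2 a b -> r2 a' b' -> cross_shape r1 r2 \/ cross_shape r2 r1.
  exact: two_matchings_cross un raa rbb.
have done2 : r2 a b' -> r2 a' b -> cross_shape r1 r2 \/ cross_shape r2 r1.
  exact: two_matchings_cross un3 raa rbb'.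
move: un' (s2 _ _ rxx) (s2 _ _ ryy); rewrite /joins !inE !xpair_eqE.
move=> un'; do 2![case/orP=> [/or4P[]|/or4P[]] /andP[/eqP ? /eqP ?]]; subst;
  move: un'; rewrite /= !inE ?eqxx ?orbT ?andbF //= => _;
  by [apply: done1; auto | apply: done2; auto].
Qed.

(** * Intersecting 3-graphs *)

Section ThreeGraphs.
Variables (T : finType) (H : {set {set T}}).
Hypotheses (H3g : three_graph H) (Hint : intersecting H).
Implicit Types (v w x y a b : T) (e : {set T}).

(** The link of [v1] after deleting [v2]: including [v2] in the [uniq] condition discards the edges
    through both vertices. *)
Definition link v1 v2 : rel T :=
  fun a b => uniq [:: v1; v2; a; b] && ([set v1; a; b] \in H).

Definition side v1 v2 := [set e in H | (v1 \in e) && (v2 \notin e)].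

Definition over x y := [set e in H | [set x; y] \subset e].

(** The codegree of x and y as a set of vertices rather than of edges, so that it can be compared
    with an edge missing both. *)
Definition third x y :=
  [set z | [&& z != x, z != y & [set x; y; z] \in H]].

Lemma card_edge e : e \in H -> #|e| = 3.
Proof. by move=> eH; apply/eqP; move/forall_inP: H3g; apply. Qed.

Lemma edges_meet e f : e \in H -> f \in H -> exists2 x, x \in e & x \in f.
Proof.
move=> eH fH; have /forall_inP/(_ f fH)/set0Pn[x] := forall_inP Hint e eH.
by rewrite inE => /andP[]; exists x.
Qed.

Lemma edge_in v e : e \in H -> v \in e ->
  exists a b, [/\ uniq [:: v; a; b] & e = [set v; a; b]].
Proof.
move=> eH ve; have := cardsD1 v e; rewrite card_edge // ve.
case=> /esym/eqP/cards2P[a [b [ab eD]]].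
have : v \notin e :\ v by rewrite !inE eqxx.
rewrite eD !inE negb_or => /andP[va vb]; exists a, b.
by rewrite /= !inE negb_or va vb ab -(setD1K ve) eD setUA.
Qed.

Lemma edge_pair x y e : e \in H -> x != y -> x \in e -> y \in e ->
  exists2 z, z \in third x y & e = [set x; y; z].
Proof.
move=> eH xy xe ye; have [a [b [un eE]]] := edge_in eH xe.
have swap : [set x; a; b] = [set x; b; a] by rewrite setUAC.
move: ye un; rewrite eE /= !inE (eq_sym y) (negPf xy) /= !negb_or !andbT.
case/orP=> /eqP yE; subst y => /andP[/andP[xa xb] ab].
  by exists b; rewrite // !inE eq_sym xb eq_sym ab -eE.
by exists a; rewrite ?swap // !inE eq_sym xa ab -swap -eE.
Qed.

Lemma edge_side v1 v2 e : v1 != v2 -> e \in side v1 v2 ->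
  exists a b, link v1 v2 a b /\ e = [set v1; a; b].
Proof.
rewrite inE => v12 /and3P[eH v1e v2e].
have [a [b [un eE]]] := edge_in eH v1e; exists a, b; split => //.
rewrite /link -eE eH andbT; move: v2e un v12; rewrite eE /= !inE !negb_or.
by rewrite (eq_sym v2 v1) => /andP[/andP[-> ->] ->] /andP[/andP[-> ->] ->].
Qed.

Lemma edge_cases v1 v2 e : v1 != v2 -> e \in H -> (v1 \in e) || (v2 \in e) ->
  [\/ [set v1; v2] \subset e,
      exists a b, link v1 v2 a b /\ e = [set v1; a; b]
    | exists a b, link v2 v1 a b /\ e = [set v2; a; b]].
Proof.
move=> v12 eH; have [v1e|v1e] := boolP (v1 \in e);
  have [v2e|v2e] := boolP (v2 \in e) => //.
- by constructor 1; apply/subsetP => x; rewrite !inE => /orP[] /eqP->.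
- by constructor 2; apply: edge_side => //; rewrite inE eH v1e v2e.
- by constructor 3; apply: edge_side; rewrite 1?eq_sym // inE eH v1e v2e.
Qed.

Lemma link_graph v1 v2 : graph (link v1 v2).
Proof.
split=> [a b|a]; rewrite /link; last by rewrite /= !inE eqxx !andbF.
rewrite setUAC; congr (_ && _).
by rewrite /= !inE (eq_sym a b); do !case: (_ == _).
Qed.

Lemma link_crossing v1 v2 : crossing (link v1 v2) (link v2 v1).
Proof.
move=> a b c d /andP[un1 eH] /andP[un2 fH].
have [x] := edges_meet eH fH; move: un1 un2.
rewrite !inE => un1 un2 /orP[/orP[]|] /eqP-> /orP[/orP[]|] /eqP E; subst;
  move: un1 un2; rewrite /= !inE ?eqxx ?orbT ?andbF //= => _ _;
  by [constructor 1 | constructor 2 | constructor 3 | constructor 4].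
Qed.

Lemma side_joins v1 v2 s : v1 != v2 -> subrel (link v1 v2) (joins s) ->
  side v1 v2 \subset [set:: [seq [set v1; p.1; p.2] | p <- s]].
Proof.
move=> v12 sub; apply/subsetP => e /(edge_side v12)[a [b [/sub + ->]]].
rewrite inE => /orP[ab|ba]; last rewrite setUAC;
  by apply/mapP; first [by exists (a, b) | by exists (b, a)].
Qed.

Lemma card_side_joins v1 v2 s : v1 != v2 -> subrel (link v1 v2) (joins s) ->
  #|side v1 v2| <= size s.
Proof.
move=> v12 /(side_joins v12)/subset_leq_card/leq_trans; apply.
rewrite cardsE -(size_map (fun p => [set v1; p.1; p.2])); exact: card_size.
Qed.

Lemma card_over x y : x != y -> #|over x y| <= #|third x y|.
Proof.
move=> xy; apply: leq_trans (leq_imset_card (fun z => [set x; y; z]) _).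
apply/subset_leq_card/subsetP => e; rewrite inE => /andP[eH /subsetP s].
have [||z zt ->] := edge_pair eH xy; first by apply: s; rewrite !inE eqxx.
  by apply: s; rewrite !inE eqxx orbT.
exact: imset_f.
Qed.

Lemma link_edge v1 v2 a b : link v1 v2 a b -> [set v1; a; b] \in H.
Proof. by case/andP. Qed.

Lemma link_uniq v1 v2 a b : link v1 v2 a b -> uniq [:: v1; v2; a; b].
Proof. by case/andP. Qed.

Lemma in_triples S e : e \in H -> (e \in triples_over S) = (S \subset e).
Proof. by move=> eH; rewrite inE card_edge. Qed.

Lemma card_setI_ge2 (A B : {set T}) x y :
  x != y -> x \in A -> x \in B -> y \in A -> y \in B -> 2 <= #|A :&: B|.
Proof.
move=> xy xA xB yA yB; rewrite (cardsD1 x) inE xA xB (cardsD1 y) !inE.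
by rewrite eq_sym xy yA yB.
Qed.

Lemma card_setI3 (S : {set T}) a b c : uniq [:: a; b; c] ->
  #|[set a; b; c] :&: S| = (a \in S) + (b \in S) + (c \in S).
Proof.
move=> un; rewrite -addnA -[c \in S : nat]addn0.
rewrite -[RHS]/(count [in S] [:: a; b; c]) -size_filter.
rewrite -(card_uniqP (filter_uniq _ un)); apply: eq_card => x.
by rewrite mem_filter !inE andbC orbA.
Qed.

(** * Two covering vertices: containment in the constructions *)

Lemma contained_cross v1 v2 : v1 != v2 ->
    {in H, forall e, (v1 \in e) || (v2 \in e)} ->
  cross_shape (link v1 v2) (link v2 v1) -> contained_HS_to_H5 H.
Proof.
move=> v12 cov; have v21 : v2 != v1 by rewrite eq_sym.
have cases e (eH : e \in H) := edge_cases v12 eH (cov e eH).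
have cross := @link_crossing v1 v2.
have listed u1 u2 (s : seq (T * T)) c d : subrel (link u1 u2) (joins s) ->
    link u1 u2 c d -> [set u1; c; d] \in [seq [set u1; p.1; p.2] | p <- s].
  move=> sub /sub /orP[cd|dc]; last rewrite setUAC;
    by apply/mapP; first [by exists (c, d) | by exists (d, c)].
case=> [none|a b lab sub|w u v lu lv uv sub
  |w u /link_uniq un star|a b c lab lbc lca sub
  |a a' b b' /link_uniq una /link_uniq unb un s1 s2
  |a a' b b' /link_uniq una /link_uniq unb un s1 s2].
(* No edge contains [v1] without [v2], so all of them contain [v2]. *)
- left; constructor 1; exists v2; apply/subsetP => e eH.
  rewrite in_triples // sub1set.
  case: (cases e eH) => [/subsetP|[a [b []]]|[a [b [_ ->]]]].
  + by apply; rewrite !inE eqxx orbT.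
  + by rewrite (negPf (none a b)).
  + by rewrite !inE eqxx.
(* The centre is [v1]: an edge through it but not [v2] must meet ab, and the only edge avoiding [v1]
   is the extra triple. *)
- left; constructor 3; exists v1, v2, a, b; split.
    by move: (link_uniq lab); decide_eqs.
  apply/subsetP => e eH; rewrite !in_setU !in_triples //.
  case: (cases e eH) => [->//|[c [d [lcd ->]]]|
      [c [d [/(listed _ _ _ _ _ sub) ecd ->]]]].
    rewrite !subUset !sub1set !inE !eqxx.
    by case: (cross _ _ _ _ lcd lab) => ->; rewrite eqxx !orbT.
  by move: ecd; rewrite !inE => ->; rewrite !orbT.
- left; constructor 4; exists v1, v2, w, u, v; split.
    by move: (link_uniq lu) (link_uniq lv) uv; decide_eqs.
  apply/subsetP => e eH; rewrite !in_setU !in_triples //.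
  case: (cases e eH) => [->//|[c [d [lcd ->]]]|
      [c [d [/(listed _ _ _ _ _ sub) ecd ->]]]].
    case: (eqVneq c w) => [->|cw].
      by rewrite !subUset !sub1set !inE !eqxx !orbT.
    case: (eqVneq d w) => [->|dw].
      by rewrite !subUset !sub1set !inE !eqxx !orbT.
    (* A pair that avoids [w] and meets both wu and wv is uv. *)
    suff -> : [set v1; c; d] = [set v1; u; v] by rewrite !inE !eqxx !orbT.
    case: (cross _ _ _ _ lcd lu) (cross _ _ _ _ lcd lv) cw dw uv;
      by move=> ? [] ?; subst; rewrite ?eqxx // setUAC.
  by move: ecd; rewrite !inE => /orP[] ->; rewrite !orbT.
- left; constructor 2; exists v1, v2, w; split.
    by move: un; decide_eqs.
  have [v1w v2w] : v1 != w /\ v2 != w by move: un; decide_eqs.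
  apply/subsetP => e eH; rewrite inE card_edge //=.
  case: (cases e eH) => [/subsetP s12|[c [d [lcd ->]]]|[c [d [lcd ->]]]].
  + by apply: (card_setI_ge2 v12); rewrite ?s12 // !inE eqxx ?orbT.
  + apply: (card_setI_ge2 v1w); rewrite !inE ?eqxx ?orbT //.
    by case: (star c d); rewrite ?lcd // => ->; rewrite eqxx !orbT.
  + apply: (card_setI_ge2 v2w); rewrite !inE ?eqxx ?orbT //.
    by case: (star c d); rewrite ?lcd ?orbT // => ->; rewrite eqxx !orbT.
- right; constructor 1; exists v1, v2, a, b, c.
  have un : uniq [:: v1; v2; a; b; c].
    by move: (link_uniq lab) (link_uniq lbc) (link_uniq lca); decide_eqs.
  split=> //; apply/subsetP => e eH.
  (* Only the six triples made of [v1] or [v2] and a side of the triangle remain to be checked, by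
     counting intersections. *)
  suff tri u s : u \in [:: v1; v2] -> [set u; s.1; s.2] \in H ->
      s \in [:: (a, b); (b, c); (c, a)] -> [set u; s.1; s.2] \in H3 v1 v2 a b c.
    have mem u1 u2 p q : link u1 u2 p q ->
        subrel (link u1 u2) (joins [:: (a, b); (b, c); (c, a)]) ->
        u1 \in [:: v1; v2] ->
        [set u1; p; q] \in H3 v1 v2 a b c.
      move=> lpq /listed/(_ lpq)/mapP[s si eE] ui; rewrite eE.
      by apply: tri; rewrite // -eE (link_edge lpq).
    case: (cases e eH) => [s12|[p [q [lpq ->]]]|[p [q [lpq ->]]]].
    + by rewrite in_setU in_triples // s12.
    + by apply: mem lpq _ _; rewrite ?inE ?eqxx // => x y lxy;
        apply: sub; rewrite lxy.
    + by apply: mem lpq _ _; rewrite ?inE ?eqxx ?orbT // => x y lxy;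
        apply: sub; rewrite lxy orbT.
  move=> ui sH si; rewrite in_setU; apply/orP; right; rewrite inE card_edge //=.
  have us : uniq [:: u; s.1; s.2].
    by move: ui si un; rewrite !inE => /orP[] /eqP -> /or3P[] /eqP ->;
      decide_eqs.
  rewrite !card_setI3 //.
  by move: ui si un; rewrite !inE => /orP[] /eqP -> /or3P[] /eqP ->;
      decide_eqs.
- right; constructor 2; exists v1, v2, a, a', b, b'; split.
    by move: una unb un; decide_eqs.
  apply/subsetP => e eH; rewrite in_setU in_triples //.
  apply/orP; case: (cases e eH) => [->|[c [d [lcd ->]]]|[c [d [lcd ->]]]];
    [by left | right | right].
  + by have := listed _ _ _ _ _ s1 lcd; rewrite !inE => /orP[] ->; rewrite ?orbT.
  + by have := listed _ _ _ _ _ s2 lcd; rewrite !inE => /or4P[] ->; rewrite ?orbT.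
- right; constructor 3; exists v1, v2, a, a', b, b'; split.
    by move: una unb un; decide_eqs.
  apply/subsetP => e eH; rewrite in_setU in_triples //.
  apply/orP; case: (cases e eH) => [->|[c [d [lcd ->]]]|[c [d [lcd ->]]]];
    [by left | right | right].
  + by have := listed _ _ _ _ _ s1 lcd; rewrite !inE => /or3P[] ->; rewrite ?orbT.
  + by have := listed _ _ _ _ _ s2 lcd; rewrite !inE => /or3P[] ->; rewrite ?orbT.
Qed.

Lemma contained_cover x y :
  {in H, forall e, (x \in e) || (y \in e)} -> contained_HS_to_H5 H.
Proof.
move=> cov; case: (eqVneq x y) => [?|xy].
  subst y; left; constructor 1; exists x; apply/subsetP => e eH.
  by rewrite in_triples // sub1set; have := cov e eH; rewrite orbb.
have [] := cross_shapeP (@link_crossing x y) (link_graph x y) (link_graph y x).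
  exact: contained_cross.
by apply: contained_cross; rewrite 1?eq_sym // => e /cov; rewrite orbC.
Qed.

(** * The cover number *)

Lemma covering_setT : covering H [set: T].
Proof.
apply/forall_inP => e eH; rewrite setTI -card_gt0; by rewrite card_edge.
Qed.

Lemma tau_cover : exists2 S, covering H S & #|S| = tau H.
Proof.
rewrite /tau; case: arg_minnP => [|S covS _]; first exact: covering_setT.
by exists S. Qed.

Lemma tau_le S : covering H S -> tau H <= #|S|.
Proof.
rewrite /tau => covS; case: arg_minnP => [|S' _ min].
  exact: covering_setT.
exact: min. Qed.

Lemma tau_gt2 x y :
  2 < tau H -> exists2 e, e \in H & (x \notin e) && (y \notin e).
Proof.
move=> tau2; have : ~~ covering H [set x; y].
  apply: contraL tau2 => /tau_le; rewrite -leqNgt cards2 => /leq_trans; apply.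
  by case: (_ != _).
case/forall_inPn => e eH; rewrite negbK => /eqP/setP xye; exists e => //.
by apply/andP; split; [have := xye x|have := xye y];
  rewrite !inE eqxx ?orbT /= => ->.
Qed.

Lemma contained_tau_le2 : 0 < #|T| -> tau H <= 2 -> contained_HS_to_H5 H.
Proof.
case/card_gt0P => t _ tau2; have [S /forall_inP covS cardS] := tau_cover.
have [x [y Sxy]] : exists x y, S \subset [set x; y].
  (* A cover with fewer than two vertices is padded by repetition, or by the arbitrary vertex [t]
     when it is empty; [contained_cover] allows x = y. *)
  rewrite -cardS in tau2; case: (set_0Vmem S) => [->|[x xS]].
    by exists t, t; rewrite sub0set.
  case: (set_0Vmem (S :\ x)) => [S0|[y ySx]].
    by exists x, x; rewrite -(setD1K xS) S0 setU0 subsetUl.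
  exists x, y; rewrite -(setD1K xS) setUS //.
  have: #|S :\ x| <= 1 by move: tau2; rewrite (cardsD1 x) xS.
  rewrite (cardsD1 y) ySx ltnS leqn0 cards_eq0 => /eqP S0.
  by rewrite -(setD1K ySx) S0 setU0.
apply: (@contained_cover x y) => e eH.
have /set0Pn[z] := covS e eH; rewrite inE => /andP[/(subsetP Sxy)].
by rewrite !inE => /orP[] /eqP -> ->; rewrite ?orbT.
Qed.

(** An edge xyz can meet [e] only in z. *)
Lemma third_sub x y e :
  e \in H -> x \notin e -> y \notin e -> third x y \subset e.
Proof.
move=> eH xe ye; apply/subsetP => z; rewrite inE => /and3P[_ _ tH].
have [t] := edges_meet tH eH; rewrite !inE => /orP[/orP[]|] /eqP -> //.
  by rewrite (negPf xe).
by rewrite (negPf ye).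
Qed.

Lemma third_sym x y : third x y = third y x.
Proof. by apply/setP => z; rewrite !inE andbCA (setUC [set x]). Qed.

Lemma leq_cardU (A B : {set {set T}}) m n :
  #|A| <= m -> #|B| <= n -> #|A :|: B| <= m + n.
Proof. by move=> Am Bn; rewrite (leq_trans (leq_card_setU _ _).1) ?leq_add. Qed.

(** * At most ten edges when no two vertices cover *)

Section NoSmallCover.
Hypothesis no_cover :
  forall x y, exists2 e, e \in H & (x \notin e) && (y \notin e).

(** Take an edge missing x and z. If it also missed y, it would contain all of [third x y], hence
    z. *)
Lemma side_missing x y z : z \in third x y ->
  exists2 e, e \in side y x & z \notin e.
Proof.
move=> zt; have [e eH /andP[xe ze]] := no_cover x z; exists e => //.
rewrite inE eH xe andbT /=; apply: contraT => ye.
by rewrite (subsetP (third_sub eH xe ye) z zt) in ze.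
Qed.

Lemma card_third_le3 x y : #|third x y| <= 3.
Proof.
have [e eH /andP[xe ye]] := no_cover x y.
by rewrite -(card_edge eH) subset_leq_card ?third_sub.
Qed.

(** Let d be the size of [third x y], so d is 2 or 3 and bounds every codegree. Edges through x that
    all contain one further fixed vertex number at most d. The empty shape is impossible, since
    [side_missing] gives edges on both sides. *)
Lemma card_sides x y : x != y -> 1 < #|third x y| ->
    (forall a b, a != b -> #|over a b| <= #|third x y|) ->
  cross_shape (link x y) (link y x) -> #|side x y| + #|side y x| <= 6.
Proof.
move=> xy t2 max; have yx : y != x by rewrite eq_sym.
have cross := @link_crossing x y; have t3 := card_third_le3 x y.
case=> [none|a b lab sub|w u v lu lv uv sub
  |w u lwu star|a b c lab lbc lca sub|a a' b b' la lb un s1 s2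
  |a a' b b' la lb un s1 s2].
- have /card_gt0P[z zt] := ltnW t2; rewrite third_sym in zt.
  have [e es _] := side_missing zt.
  by have [a [b [lab _]]] := edge_side xy es; rewrite (negPf (none a b)) in lab.
- have s2 := card_side_joins yx sub; have [xa xb] : x != a /\ x != b.
    by move: (link_uniq lab); decide_eqs.
  have s1 : #|side x y| <= #|third x y| + #|third x y|.
    apply: leq_trans (leq_cardU (max _ _ xa) (max _ _ xb)).
    apply/subset_leq_card/subsetP => e es; have := es.
    have [c [d [lcd eE]]] := edge_side xy es; rewrite !inE => /and3P[-> xe _].
    rewrite !subUset !sub1set xe eE !inE.
    by case: (cross _ _ _ _ lcd lab) => ->; rewrite eqxx !orbT.
  (* For d = 2 the total is at most 2 + 2 + 1. *)
  case: (leqP #|third x y| 2) => [d2|d3].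
    apply: leq_trans (leq_add s1 s2) _.
    by rewrite addn1 ltnS (leq_trans (leq_add d2 d2)).
  (* If d = 3, the edge e0 = N missing x and y meets [set y; a; b] in a vertex z,
     and then x and z would cover H. *)
  have [e0 e0H /andP[xe0 ye0]] := no_cover x y.
  have e0E : third x y = e0.
    by apply/eqP; rewrite eqEcard third_sub // card_edge.
  have [z zt zab] : exists2 z, z \in third x y & z \in [set y; a; b].
    by rewrite e0E; apply: edges_meet e0H _; exact: link_edge lab.
  have [e es] := side_missing zt.
  have /subsetP/(_ e es) := side_joins yx sub.
  by rewrite !inE => /eqP ->; rewrite zab.
- have s2 := card_side_joins yx sub; have xw : x != w.
    by move: (link_uniq lu); decide_eqs.
  (* At most three edges pass through x and w; the only other possible one is xuv. The other side
     has at most two edges. *)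
  have s1 : #|side x y| <= 3 + 1.
    have one : #|[set [set x; u; v]]| <= 1 by rewrite cards1.
    apply: leq_trans (leq_cardU (leq_trans (max _ _ xw) t3) one).
    apply/subset_leq_card/subsetP => e es; have := es.
    have [c [d [lcd eE]]] := edge_side xy es; rewrite !inE => /and3P[-> xe _].
    rewrite !subUset !sub1set xe eE !inE.
    case: (eqVneq w c) => [_|wc]; first by rewrite !orbT.
    case: (eqVneq w d) => [_|wd]; first by rewrite !orbT.
    apply/orP; right.
    case: (cross _ _ _ _ lcd lu) (cross _ _ _ _ lcd lv) wc wd uv;
      by move=> ? [] ?; subst; rewrite ?eqxx // setUAC.
  exact: leq_add s1 s2.
- have [xw yw] : x != w /\ y != w by move: (link_uniq lwu); decide_eqs.
  (* The alternative [same] lets one argument serve both sides of the star. *)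
  have through p q : p != q -> p != w ->
      link p q =2 link x y \/ link p q =2 link y x ->
      #|side p q| <= 3.
    move=> pq pw same; apply: leq_trans (leq_trans (max _ _ pw) t3).
    apply/subset_leq_card/subsetP => e es; have := es.
    have [c [d [lcd eE]]] := edge_side pq es; rewrite !inE => /and3P[-> pe _].
    rewrite !subUset !sub1set pe eE !inE.
    by case: (star c d) => [|->|->]; rewrite ?eqxx ?orbT //;
      case: same => <-; rewrite lcd ?orbT.
  by apply: (@leq_add _ _ 3 3); apply: through; auto.
- pose abc := [:: (a, b); (b, c); (c, a)].
  apply: (@leq_add _ _ 3 3).
    by apply: (@card_side_joins _ _ abc xy) => p q l; apply: sub; rewrite l.
  by apply: (@card_side_joins _ _ abc yx) => p q l; apply: sub; rewrite l orbT.
- exact: (@leq_add _ _ 2 4) (card_side_joins xy s1) (card_side_joins yx s2).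
- exact: (@leq_add _ _ 3 3) (card_side_joins xy s1) (card_side_joins yx s2).
Qed.

(** Every edge through x meets a fixed edge missing x, hence contains x and one of three
    vertices. *)
Lemma card_degree x d :
  (forall a b, a != b -> #|over a b| <= d) ->
  #|[set e in H | x \in e]| <= d + d + d.
Proof.
move=> max; have [f fH /andP[xf _]] := no_cover x x.
have [p pf] : exists p, p \in f by apply/card_gt0P; rewrite card_edge.
have [a [b [_ fE]]] := edge_in fH pf; move: xf; rewrite fE !inE !negb_or.
case/andP=> /andP[xp xa] xb.
apply: leq_trans (leq_cardU (leq_cardU (max _ _ xp) (max _ _ xa)) (max _ _ xb)).
apply/subset_leq_card/subsetP => e; rewrite inE => /andP[eH xe].
have [z ze zf] := edges_meet eH fH; rewrite !inE eH !subUset !sub1set xe /=.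
by move: zf; rewrite fE !inE => /orP[/orP[]|] /eqP <-; rewrite ze ?orbT.
Qed.

Lemma card_le10_max x y : x != y ->
    (forall a b, a != b -> #|third a b| <= #|third x y|) -> #|H| <= 10.
Proof.
move=> xy maxt.
have max a b (ab : a != b) := leq_trans (card_over ab) (maxt a b ab).
have [e0 e0H /andP[xe0 ye0]] := no_cover x y.
(* If d is at most 1, every degree is at most 3, and each edge contains a vertex of [e0]. *)
case: (leqP #|third x y| 1) => [t1|t2].
  have deg v := leq_trans (card_degree v max) (leq_add (leq_add t1 t1) t1).
  have [p pe] : exists p, p \in e0 by apply/card_gt0P; rewrite card_edge.
  have [a [b [_ e0E]]] := edge_in e0H pe.
  apply: leq_trans (_ : 3 + 3 + 3 <= 10) => //.
  apply: leq_trans (leq_cardU (leq_cardU (deg p) (deg a)) (deg b)).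
  apply/subset_leq_card/subsetP => e eH; have [z ze] := edges_meet eH e0H.
  by rewrite e0E !inE eH => /orP[/orP[]|] /eqP <-; rewrite ze ?orbT.
pose rest := [set e in H | (x \notin e) && (y \notin e)].
have sides : #|side x y| + #|side y x| <= 6.
  have [shape|shape] :=
    cross_shapeP (@link_crossing x y) (link_graph x y) (link_graph y x).
    exact: card_sides.
  by rewrite addnC; apply: card_sides; rewrite 1?eq_sym ?(third_sym y).
(* An edge missing x and y contains [third x y]. If that set has three elements it is the only such
   edge, giving 3 + 1; if it has two, those edges contain a fixed pair, giving 2 + 2. *)
have others : #|over x y| + #|rest| <= 4.
  have sub e : e \in rest -> e \in H /\ third x y \subset e.
    by rewrite inE => /and3P[eH xe ye]; split; rewrite ?third_sub.
  have := card_third_le3 x y; rewrite leq_eqVlt => /orP[/eqP t3|]; last first.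
    rewrite ltnS => t_le2; have /card_gt1P[a [b [at_ bt ab]]] := t2.
    apply: (@leq_add _ _ 2 2); first exact: leq_trans (max _ _ xy) t_le2.
    apply: leq_trans (leq_trans (max _ _ ab) t_le2).
    apply/subset_leq_card/subsetP => e /sub[eH /subsetP te].
    by rewrite inE eH subUset !sub1set !te.
  apply: (@leq_add _ _ 3 1); first by rewrite -t3 max.
  rewrite -(cards1 (third x y)); apply/subset_leq_card/subsetP => e /sub[eH te].
  by rewrite inE eq_sym eqEcard te card_edge // t3.
have -> : H = (over x y :|: rest) :|: (side x y :|: side y x).
  apply/setP => e; rewrite !inE subUset !sub1set.
  by case: (e \in H) => //=; case: (x \in e); case: (y \in e).
apply: leq_trans (leq_add others sides).
by apply: leq_cardU; apply: leq_cardU.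
Qed.

Lemma card_le10 : #|H| <= 10.
Proof.
case: (set_0Vmem H) => [->|[e eH]]; first by rewrite cards0.
have [x xe] : exists x, x \in e by apply/card_gt0P; rewrite card_edge.
have [a [b [un _]]] := edge_in eH xe.
(* The maximum ranges over pairs of distinct vertices; an edge provides one such pair. *)
pose P (p : T * T) := p.1 != p.2.
have P0 : P (x, a) by move: un; rewrite /P; decide_eqs.
case: (arg_maxnP (fun p => #|third p.1 p.2|) P0) => -[p q] pq max.
by apply: (card_le10_max pq) => c d cd; apply: (max (c, d)).
Qed.

End NoSmallCover.

Lemma card_tau_gt2 : 2 < tau H -> #|H| <= 10.
Proof. by move=> tau2; apply: card_le10 => x y; apply: tau_gt2. Qed.

End ThreeGraphs.

(** * Sizes of H_3, H_4 and H_5 *)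

Lemma leq_card_few_extra (T : finType) (H X : {set {set T}}) (v1 v2 : T) :
  v1 != v2 -> H \subset triples_over [set v1; v2] :|: X -> #|X| <= 6 ->
  #|H| <= #|T| + 4.
Proof.
move=> v12 /subset_leq_card HX X6; apply: leq_trans HX _.
(* There are n - 2 triples over the pair, and (n - 2) + 6 = n + 4. *)
have T2 : #|~: [set v1; v2]| + 2 = #|T|.
  by rewrite -(cardsC [set v1; v2]) cards2 v12 addnC.
rewrite -T2 -addnA; apply: leq_cardU => //.
apply: leq_trans (leq_imset_card (fun z => [set v1; v2; z]) _).
have G3 : three_graph (triples_over [set v1; v2]).
  by apply/forall_inP => e; rewrite inE => /andP[].
apply/subset_leq_card/subsetP => e eT.
have /andP[_ /subsetP s] : (#|e| == 3) && ([set v1; v2] \subset e).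
  by rewrite inE in eT.
have [||z] := edge_pair G3 eT v12; try by apply: s; rewrite !inE eqxx ?orbT.
by rewrite inE => /and3P[z1 z2 _] ->; apply: imset_f; rewrite !inE negb_or z1.
Qed.

Lemma card_set_seq (T : finType) (s : seq T) : #|[set:: s]| <= size s.
Proof. by rewrite cardsE card_size. Qed.

(** Such a triple is determined by its vertex in [V] and the vertex of [Y] that it misses, which
    leaves at most 2 * 3 choices. *)
Lemma leq_card_H3_extra (T : finType) (V Y : {set T}) : #|V| <= 2 -> #|Y| = 3 ->
    [disjoint V & Y] ->
  #|[set e : {set T} | [&& #|e| == 3, #|e :&: V| == 1 & #|e :&: Y| == 2]]| <= 6.
Proof.
move=> V2 Y3 dis.
apply: leq_trans (_ : #|setX V Y| <= _); last first.
  by rewrite cardsX Y3 (leq_mul V2 (leqnn 3)).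
apply: leq_trans (leq_imset_card (fun p => p.1 |: (Y :\ p.2)) _).
apply/subset_leq_card/subsetP => e; rewrite inE.
move=> /and3P[/eqP e3 /cards1P[u eV] /eqP eY].
have /eqP/cards1P[z Yz] : #|Y :\: e| = 1.
  by have := cardsID e Y; rewrite Y3 setIC eY => -[].
have uV : u \in e :&: V by rewrite eV set11.
have zY : z \in Y :\: e by rewrite Yz set11.
have eYE : e :&: Y = Y :\ z by rewrite -Yz setDDr setDv set0U setIC.
apply/imsetP; exists (u, z).
  by move: uV zY; rewrite !inE => /andP[_ ->] /andP[].
(* The traces of [e] on [V] and [Y] are disjoint and have 1 + 2 = 3 elements, so they fill [e]. *)
apply/esym/eqP; rewrite eqEcard /= -eYE e3 -eV; apply/andP; split.
  by rewrite subUset !subsetIl.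
rewrite cardsU eV cards1 eY -eV.
by rewrite setIACA setIid (eqP (_ : V :&: Y == set0)) ?setI0 ?cards0 // setI_eq0.
Qed.

Lemma contained_large (T : finType) (H : {set {set T}}) :
  #|T| + 4 < #|H| -> contained_HS_to_H5 H -> contained_HS_to_H2 H.
Proof.
rewrite ltnNge => /negP large [//|small]; case: large; case: small.
- move=> [v1 [v2 [y1 [y2 [y3 [un sub]]]]]].
  apply: leq_card_few_extra sub _; first by move: un; decide_eqs.
  apply: leq_card_H3_extra; first by rewrite cards2; case: (_ == _).
    rewrite -(setIid [set y1; _; _]) card_setI3 ?inE ?eqxx ?orbT //.
    by move: un; decide_eqs.
  rewrite disjoints_subset; apply/subsetP => x; rewrite !inE; move: un.
  by move=> un /orP[] /eqP ->; move: un; decide_eqs.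
- move=> [v1 [v2 [a [a' [b [b' [un sub]]]]]]].
  apply: leq_card_few_extra sub _; first by move: un; decide_eqs.
  apply: leq_trans (card_set_seq [:: [set v1; a; a']; [set v1; b; b'];
    [set v2; a; b]; [set v2; a; b']; [set v2; a'; b]; [set v2; a'; b']]).
  by rewrite subset_leq_card //; apply/subsetP => e; rewrite !inE -!orbA.
- move=> [v1 [v2 [a [a' [b [b' [un sub]]]]]]].
  apply: leq_card_few_extra sub _; first by move: un; decide_eqs.
  apply: leq_trans (card_set_seq [:: [set v1; a; a']; [set v1; b; b'];
    [set v1; a; b']; [set v2; a; b']; [set v2; a; b]; [set v2; a'; b']]).
  by rewrite subset_leq_card //; apply/subsetP => e; rewrite !inE -!orbA.
Qed.

Theorem theorem7 (T : finType) (H : {set {set T}})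
    (H3graph : three_graph H) (Hint : intersecting H) (Hn : 6 <= #|T|) :
  [/\ tau H <= 2 -> contained_HS_to_H5 H,
      11 <= #|H| -> contained_HS_to_H5 H
    & #|T| + 4 < #|H| -> contained_HS_to_H2 H].
Proof.
have small_tau : tau H <= 2 -> contained_HS_to_H5 H.
  by apply: contained_tau_le2 => //; apply: leq_trans Hn.
have large : 11 <= #|H| -> contained_HS_to_H5 H.
  move=> H11; apply: small_tau; rewrite leqNgt; apply: contraL H11.
  by rewrite -leqNgt; apply: card_tau_gt2.
split=> // Hlarge; apply: contained_large (Hlarge) (large _).
(* Since n is at least 6, more than n + 4 edges means at least 11. *)
by apply: leq_ltn_trans Hlarge; rewrite (leq_add Hn (leqnn 4)).
Qed.
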